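(* Let $\mathsf V=(\mathsf V,\otimes,\mathsf k)$ be a quantale whose underlying complete lattice is constructively completely distributive. Then a $\mathsf V$-closure space $(X,c)$ is a $\mathsf V$-approach space if and only if its closure tower $(c^v)_{v\in\mathsf V}$ satisfies, for all $v\in\mathsf V$ with $v>\bot$ and all $A,B\subseteq X$: (C4) $c^v\emptyset=\emptyset$; (C5) $c^v(A\cup B)=\bigcap_{u\ll v}(c^uA\cup c^uB)$.
   Context: A quantale $\mathsf V=(\mathsf V,\otimes,\mathsf k)$ is a complete lattice with a (not necessarily commutative) monoid structure whose operation $\otimes$ preserves arbitrary suprema in each variable; no relation between $\mathsf k$ and $\bot,\top$ is assumed. For $u,v\in\mathsf V$, $u\ll v$ ($u$ totally below $v$) means: for every $D\subseteq\mathsf V$ with $v\le\bigvee D$ there is $d\in D$ with $u\le d$. $\mathsf V$ is constructively completely distributive if $v=\bigvee\{u\in\mathsf V\mid u\ll v\}$ for every $v\in\mathsf V$. A $\mathsf V$-closure space $(X,c)$ is a set $X$ with a map $c:\mathsf PX\to\mathsf V^X$ ($\mathsf PX$ the power set) such that (R') $\mathsf k\le c(\{x\})(x)$ for all $x\in X$; (T') $\big(\bigwedge_{y\in B}\bigvee_{A\in\mathcal A}(cA)(y)\big)\otimes (cB)(z)\le c(\bigcup\mathcal A)(z)$ for all $\mathcal A\subseteq\mathsf PX$, $B\subseteq X$, $z\in X$. It is a $\mathsf V$-approach space if in addition $(c\emptyset)(x)=\bot$ and $c(A\cup B)(x)=(cA)(x)\vee(cB)(x)$ for all $x\in X$, $A,B\subseteq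 X$. The closure tower of $(X,c)$ is the family of maps $c^v:\mathsf PX\to\mathsf PX$, $c^vA=\{x\in X\mid (cA)(x)\ge v\}$ ($v\in\mathsf V$). An intersection of subsets of $X$ over an empty index set is $X$. *)

(* Defs.v *)
From HB Require Import structures.
From mathcomp Require Import all_boot all_order.
From mathcomp Require Import boolp classical_sets.

Set Implicit Arguments.
Unset Strict Implicit.
Unset Printing Implicit Defensive.

Local Open Scope order_scope.
Local Open Scope classical_set_scope.

HB.mixin Record isCompleteLattice (d : Order.disp_t) V
    of Order.TBLattice d V := {
  bigjoin : set V -> V;
  bigjoinP : forall D : set V, isLub D (bigjoin D) }.

#[short(type="completeLatticeType")]
HB.structure Definition CompleteLattice (d : Order.disp_t) :=
  { V of Order.TBLattice d V & isCompleteLattice d V }.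

Definition bigmeet (d : Order.disp_t) (V : completeLatticeType d)
  (D : set V) : V := bigjoin (lbound D).

(* The tensor product and the unit k are the monoid operations ( *%g and 1%g )
   of the underlying [monoidType]. *)
HB.mixin Record isQuantale (d : Order.disp_t) V
    of CompleteLattice d V & Monoid V := {
  tensor_bigjoinl : forall (u : V) (D : set V),
    (bigjoin D * u)%g = bigjoin [set (v * u)%g | v in D];
  tensor_bigjoinr : forall (u : V) (D : set V),
    (u * bigjoin D)%g = bigjoin [set (u * v)%g | v in D] }.

#[short(type="quantaleType")]
HB.structure Definition Quantale (d : Order.disp_t) :=
  { V of CompleteLattice d V & Monoid V & isQuantale d V }.

Definition totally_below (d : Order.disp_t) (V : completeLatticeType d)
    (u v : V) : Prop :=
  forall D : set V, v <= bigjoin D -> exists2 w, D w & u <= w.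

Definition constructively_completely_distributive (d : Order.disp_t)
    (V : completeLatticeType d) : Prop :=
  forall v : V, v = bigjoin [set u | totally_below u v].

Record closureSpace (d : Order.disp_t) (V : quantaleType d) := ClosureSpace {
  points :> Type;
  cl : set points -> points -> V;
  cl_refl : forall x : points, (1%g : V) <= cl [set x] x;
  cl_trans : forall (F : set (set points)) (B : set points) (z : points),
    (bigmeet [set bigjoin [set cl A y | A in F] | y in B] * cl B z)%g
      <= cl (\bigcup_(A in F) A) z }.

Definition is_approach (d : Order.disp_t) (V : quantaleType d)
    (X : closureSpace V) : Prop :=
  (forall x : X, cl set0 x = \bot) /\
  (forall (A B : set X) (x : X),
    cl (A `|` B) x = Order.join (cl A x) (cl B x)).

Definition closure_tower (d : Order.disp_t) (V : quantaleType d)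
    (X : closureSpace V) (v : V) (A : set X) : set X :=
  [set x | v <= cl A x].

(* Main.v *)
Require Import Defs.
From HB Require Import structures.
From mathcomp Require Import all_boot all_order.
From mathcomp Require Import boolp classical_sets.

Import Order.LTheory.

Local Open Scope order_scope.
Local Open Scope classical_set_scope.

(** In a completely distributive lattice, [v <= Order.join a b] holds iff every
    [u] totally below [v] lies below [a] or below [b]. Hence, at each level
    [v > \bot], (C5) says exactly that [cl (A `|` B) x] and the join of
    [cl A x] and [cl B x] are above the same [v]; both values are then equal,
    and (C4) is the nullary analogue. *)

Section CompleteLattice.
Context {d : Order.disp_t} {V : completeLatticeType d}.
Implicit Types (a b u v w : V) (D : set V).

Lemma bigjoin_ub D u : D u -> u <= bigjoin D.
Proof. by move=> Du; have [ub _] := bigjoinP D; apply: ub. Qed.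

Lemma bigjoin_le D w : ubound D w -> bigjoin D <= w.
Proof. by have [_] := bigjoinP D; apply. Qed.

Lemma bigjoin_set2 a b : bigjoin [set a; b] = Order.join a b.
Proof.
apply/le_anti/andP; split.
  by apply: bigjoin_le => _ [] ->; rewrite ?leUl ?leUr.
by rewrite leUx !bigjoin_ub //=; [right | left].
Qed.

(** Left to right, total belowness is tested on the pair [[set a; b]]; right to left, [v] is the
    join of the [u] totally below it. *)
Lemma le_join_totally_below
    (hV : constructively_completely_distributive V) v a b :
  v <= Order.join a b <-> (forall u, totally_below u v -> u <= a \/ u <= b).
Proof.
split=> [vab u uv|uab].
  by have [|w [->|->]] := uv [set a; b]; rewrite ?bigjoin_set2 //; [left|right].
rewrite (hV v); apply: bigjoin_le => u /uab.
by case=> /le_trans; apply; rewrite ?leUl ?leUr.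
Qed.

(** Antisymmetry, testing at [v := a] and [v := b]; if the tested value is [\bot], the inequality is
    trivial. *)
Lemma eq_gt_bot a b :
  (forall v, \bot < v -> (v <= a <-> v <= b)) -> a = b.
Proof.
move=> ab.
have bot_or_gt w : w = \bot \/ \bot < w.
  by rewrite lt0x; case: eqP => ?; [left|right].
apply/le_anti/andP; split.
  by case: (bot_or_gt a) => [->|/ab[+ _]]; [exact: le0x | apply].
by case: (bot_or_gt b) => [->|/ab[_ +]]; [exact: le0x | apply].
Qed.

End CompleteLattice.

Theorem theorem2p8 (d : Order.disp_t) (V : quantaleType d)
    (hV : constructively_completely_distributive V) (X : closureSpace V) :
  is_approach X <->
  (forall v : V, \bot < v -> forall A B : set X,
     closure_tower v (set0 : set X) = set0 /\
     closure_tower v (A `|` B) =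
       \bigcap_(u in [set u : V | totally_below u v])
         (closure_tower u A `|` closure_tower u B)).
Proof.
split=> [[cl0 clU] v v_gt0 A B|tower].
  split; apply/seteqP; split=> x //=; rewrite /closure_tower /=.
  - by rewrite cl0 => /(lt_le_trans v_gt0); rewrite ltxx.
  (* Membership of [x] in the intersection of (C5) unfolds to the right side of
     [le_join_totally_below] for [cl A x] and [cl B x]. *)
  - by rewrite clU => /(le_join_totally_below hV).
  - by rewrite clU => xAB; apply/(le_join_totally_below hV).
split=> [x|A B x]; apply: eq_gt_bot => v v_gt0.
  (* (C4) does not involve [A] and [B], so any sets serve here. Both [v <= cl set0 x] and
     [v <= \bot] are then absurd. *)
  have [/seteqP[cl0 _] _] := tower v v_gt0 set0 set0.
  by split=> [/(cl0 x)//|/(lt_le_trans v_gt0)]; rewrite ltxx.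
have [_ /seteqP[towerU Utower]] := tower v v_gt0 A B.
split=> [/(towerU x)|/(le_join_totally_below hV)]; last exact: Utower.
by move=> xAB; apply/(le_join_totally_below hV).
Qed.
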